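(* Let $\oplus\subseteq[N]$ be a safe set and $\ominus\subseteq[N]$ a pruned set that are jointly compatible. Assume $\oplus$ is non-optimal, i.e. $\nu(\oplus)\ne F^*_\tau$, and let $\hat F^*_\tau\ge F^*_\tau$ (with $\hat F^*_\tau\in\mathbb{R}\cup\{+\infty\}$). If $s\in[N]$ satisfies $\nu(\oplus\cup\{s\})>\hat F^*_\tau$, then $s$ may be added to the pruned set, i.e. $\ominus\cup\{s\}$ is a pruned set. Moreover, $$\check F^*_\tau:=\min_{s\in[N]\setminus(\oplus\cup\ominus)}\nu(\oplus\cup\{s\})\ \le\ F^*_\tau .$$
   Context: Setting. $\xi$ is a random vector in $\mathbb{R}^p$ with finite support $\{\xi^{(1)},\dots,\xi^{(N)}\}$ of cardinality $N$ (so the scenarios $\xi^{(s)}$ are pairwise distinct), $[N]=\{1,\dots,N\}$, and $\pi^{(s)}=\mathbb{P}[\xi=\xi^{(s)}]$, with $\sum_{s}\pi^{(s)}=1$. Let $\mathcal{X}\subseteq\mathbb{R}^d$, $F:\mathbb{R}^d\to\mathbb{R}$, $c:\mathbb{R}^d\times\mathbb{R}^p\to\mathbb{R}$, $\tau\in(0,1)$, and let $M^{(s)}\in\mathbb{R}$ satisfy $M^{(s)}\ge\max_{x\in\mathcal{X}}c(x,\xi^{(s)})$ for each $s\in[N]$. For $S\subseteq[N]$ define $\nu(S)$ as the optimal value of $\min_{x\in\mathcal{X}}F(x)$ subject to $c(x,\xi^{(s)})\le 0$ for all $s\in S$. Infeasible minimization problems have value $+\infty$, unbounded ones $-\infty$;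 a minimum over an empty index set is $+\infty$. Standing assumptions. (A) For every $s\in[N]$, $\pi^{(s)}>0$ and $\nu(\{s\})>-\infty$. (B) For every $x\in\mathcal{X}$, the function $c(x,\cdot)$ is quasi-convex on $\mathbb{R}^p$. Problem (MI-CCP), with optimal value $F^*_\tau$: minimize $F(x)$ over $x\in\mathcal{X}$, $z\in\{0,1\}^N$ subject to $\sum_{s=1}^N\pi^{(s)}z_s\ge 1-\tau$ and $c(x,\xi^{(s)})\le M^{(s)}(1-z_s)$ for all $s\in[N]$. Safe set: $\oplus\subseteq[N]$ is a safe set if including the equalities $z_s=1$ for every $s\in\oplus$ in (MI-CCP) does not increase its optimal value $F^*_\tau$. Pruned set: $\ominus\subseteq[N]$ is a pruned set if including the equalities $z_s=0$ for every $s\in\ominus$ in (MI-CCP) does not increase its optimal value $F^*_\tau$. Define $\mathbf{T}(\oplus,\ominus)=\{S\subseteq[N]\setminus\ominus : \oplus\subseteq S \text{ and } \sum_{s\in S}\pi^{(s)}\ge 1-\tau\}$. The pair $(\oplus,\ominus)$ is jointly compatible if $F^*_\tau=\min_{S\in\mathbf{T}(\oplus,\ominus)}\nu(S)$ (with value $+\infty$ for an empty minimum); equivalently, including both families of equalities in (MI-CCP) simultaneously does not increase its optimal value. *)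

(* Defs.v *)
From mathcomp Require Import all_boot all_order all_algebra.
From mathcomp Require Import all_classical all_reals all_analysis.
Set Implicit Arguments.
Unset Strict Implicit.
Unset Printing Implicit Defensive.
Import Order.TTheory GRing.Theory Num.Theory.
Import numFieldNormedType.Exports.
Local Open Scope classical_set_scope.
Local Open Scope ring_scope.

(* 'rV[R]_p carries no canonical sigma-algebra; measurability with respect to
   the Borel sets of R^p is measurability of every coordinate. *)
Definition random_vector (d : measure_display) (T : measurableType d)
    (R : realType) (p : nat) (V : T -> 'rV[R]_p) : Prop :=
  forall i : 'I_p, measurable_fun [set: T] (fun w => V w ord0 i).

(* The topological support of the law of V. *)
Definition law_support (d : measure_display) (T : measurableType d)
    (R : realType) (P : probability T R) (p : nat) (V : T -> 'rV[R]_p) :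
    set 'rV[R]_p :=
  [set v | forall U : set 'rV[R]_p, open U -> U v -> (0 < P (V @^-1` U))%E].

Definition quasi_convex (R : realType) (p : nat) (g : 'rV[R]_p -> R) : Prop :=
  forall (t : R) (u v : 'rV[R]_p), 0 <= t -> t <= 1 ->
    g (t *: u + (1 - t) *: v) <= Num.max (g u) (g v).

Section ChanceConstrainedProgram.
Context (R : realType) (m p N : nat).
Context (X : set 'rV[R]_m) (F : 'rV[R]_m -> R) (c : 'rV[R]_m -> 'rV[R]_p -> R).
Context (xi : 'I_N -> 'rV[R]_p) (prb : 'I_N -> R) (tau : R) (M : 'I_N -> R).

(* Optimal values are infima in the extended reals: +oo for an infeasible
   problem, -oo for an unbounded one. *)
Definition nu (S : {set 'I_N}) : \bar R :=
  ereal_inf [set (F x)%:E | x in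
    [set x | X x /\ forall s, s \in S -> c x (xi s) <= 0]].

Definition miccp_feasible (x : 'rV[R]_m) (z : {ffun 'I_N -> bool}) : Prop :=
  [/\ X x,
    1 - tau <= \sum_(s < N) prb s * (z s)%:R &
    forall s, c x (xi s) <= M s * (1 - (z s)%:R)].

(* The optimal value of the program with the extra constraint z \in Z. *)
Definition miccp_value (Z : set {ffun 'I_N -> bool}) : \bar R :=
  ereal_inf [set (F x)%:E | x in
    [set x | exists2 z, Z z & miccp_feasible x z]].

Definition Fstar : \bar R := miccp_value setT.

Definition safe_set (Op : {set 'I_N}) : Prop :=
  (miccp_value [set z : {ffun 'I_N -> bool} |
     forall s, s \in Op -> z s = true] <= Fstar)%E.

Definition pruned_set (Om : {set 'I_N}) : Prop :=
  (miccp_value [set z : {ffun 'I_N -> bool} |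
     forall s, s \in Om -> z s = false] <= Fstar)%E.

Definition TT (Op Om : {set 'I_N}) : {set {set 'I_N}} :=
  [set S : {set 'I_N} |
    [&& S \subset ~: Om, Op \subset S & 1 - tau <= \sum_(s in S) prb s]]%SET.

Definition jointly_compatible (Op Om : {set 'I_N}) : Prop :=
  Fstar = \big[mine/+oo%E]_(S in TT Op Om) nu S.

Definition Fcheck (Op Om : {set 'I_N}) : \bar R :=
  \big[mine/+oo%E]_(s in ~: (Op :|: Om)) nu (s |: Op)%SET.

End ChanceConstrainedProgram.

(* Main.v *)
Require Import Defs.
From mathcomp Require Import all_boot all_order all_algebra.
From mathcomp Require Import all_classical all_reals all_analysis.
Set Implicit Arguments.
Unset Strict Implicit.
Unset Printing Implicit Defensive.
Import Order.TTheory GRing.Theory Num.Theory.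
Import numFieldNormedType.Exports.
Local Open Scope classical_set_scope.
Local Open Scope ring_scope.

(** Fixing the active scenarios S turns the mixed-integer program into the
    problem defining [nu S], and [nu] is monotone because a larger S means more
    constraints.  Joint compatibility says that the optimal value is a minimum
    of [nu] over the finitely many S that contain the safe set, avoid the pruned
    set and carry enough probability; when the optimal value is below +oo, some
    such S attains it ([bigmin_attained]).  This optimal S settles both claims
    by monotonicity.

    If [nu (s |: Oplus)] exceeds [Fhat], hence the optimal value, then s is not
    in S, as otherwise S would contain [s |: Oplus] and be at least as
    expensive.  So S also avoids [s |: Ominus], and its indicator vector
    witnesses that this larger set is pruned ([pruned_of_disjoint]).

    For the lower bound, non-optimality of the safe set makes S strictly larger
    than it; any scenario in the difference is a candidate in the minimum
    defining [Fcheck], with a value at most [nu S]. *)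

(** A minimum of finitely many terms is one of them or the default value +oo;
    the hypothesis excludes the default. *)
Lemma bigmin_attained (R : realType) (I : finType) (A : {pred I})
    (f : I -> \bar R) :
  (\big[mine/+oo%E]_(i in A) f i < +oo)%E ->
  exists2 i, i \in A & f i = \big[mine/+oo%E]_(i in A) f i.
Proof.
elim/big_rec: _ => [|i x iA IHx]; first by rewrite ltxx.
by rewrite /Order.min; case: ifP => // _ _; exists i.
Qed.

Section ScenarioSubsets.
Context (R : realType) (m p N : nat).
Context (X : set 'rV[R]_m) (F : 'rV[R]_m -> R) (c : 'rV[R]_m -> 'rV[R]_p -> R).
Context (xi : 'I_N -> 'rV[R]_p) (prb : 'I_N -> R) (tau : R) (M : 'I_N -> R).
Implicit Types S Op Om : {set 'I_N}.

Lemma nu_subset S1 S2 : S1 \subset S2 ->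
  (nu X F c xi S1 <= nu X F c xi S2)%E.
Proof.
move=> /fintype.subsetP S12; apply: ereal_inf_le_tmp => _ [x [Xx cx] <-].
by exists x => //; split=> // s /S12; apply: cx.
Qed.

Context (M_max : forall s, ubound [set c x (xi s) | x in X] (M s)).

(** A feasible point of the problem defining [nu S] is feasible for the
    mixed-integer program with z the indicator of S: outside S the constraint
    relaxes to the bound [M], which holds on all of X. *)
Lemma miccp_value_le_nu S (Z : set {ffun 'I_N -> bool}) :
  1 - tau <= \sum_(s in S) prb s -> Z [ffun s => s \in S] ->
  (miccp_value X F c xi prb tau M Z <= nu X F c xi S)%E.
Proof.
move=> prbS ZS; apply: ereal_inf_le_tmp => _ [x [Xx cx] <-].
exists x => //; exists [ffun s => s \in S] => //; split=> // [|s].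
- rewrite big_mkcond /= in prbS; apply: le_trans prbS _.
  by apply: ler_sum => s _; rewrite ffunE; case: (s \in S); rewrite ?mulr1 ?mulr0.
- rewrite ffunE; case: (boolP (s \in S)) => [/cx|_]; first by rewrite subrr mulr0.
  by rewrite subr0 mulr1; apply: M_max; exists x.
Qed.

Lemma pruned_of_disjoint S Om :
  1 - tau <= \sum_(s in S) prb s -> S \subset ~: Om ->
  (nu X F c xi S <= Fstar X F c xi prb tau M)%E ->
  pruned_set X F c xi prb tau M Om.
Proof.
move=> prbS SOm; apply: le_trans; apply: miccp_value_le_nu => //= s sOm.
rewrite ffunE; apply/negbTE/negP => /(fintype.subsetP SOm).
by rewrite finset.in_setC sOm.
Qed.

Lemma jointly_compatible_attained Op Om :
  jointly_compatible X F c xi prb tau M Op Om ->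
  (Fstar X F c xi prb tau M < +oo)%E ->
  exists2 S, S \in TT prb tau Op Om & nu X F c xi S = Fstar X F c xi prb tau M.
Proof. by move=> ->; apply: bigmin_attained. Qed.

End ScenarioSubsets.

Theorem proposition4 (R : realType) (d : measure_display)
  (Omega : measurableType d) (P : probability Omega R) (m p N : nat)
  (Xi : Omega -> 'rV[R]_p) (xi : 'I_N -> 'rV[R]_p) (prb : 'I_N -> R)
  (X : set 'rV[R]_m) (F : 'rV[R]_m -> R) (c : 'rV[R]_m -> 'rV[R]_p -> R)
  (tau : R) (M : 'I_N -> R)
  (Xi_random_vector : random_vector Xi)
  (xi_distinct : injective xi)
  (xi_support : law_support P Xi = range xi)
  (prbE : forall s, (prb s)%:E = P [set w | Xi w = xi s])
  (prb_sum : \sum_(s < N) prb s = 1)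
  (tau_gt0 : 0 < tau) (tau_lt1 : tau < 1)
  (M_max : forall s, ubound [set c x (xi s) | x in X] (M s))
  (prb_gt0 : forall s, 0 < prb s)
  (nu_gtNy : forall s, (-oo < nu X F c xi [set s]%SET)%E)
  (c_quasi_convex : forall x, X x -> quasi_convex (c x))
  (Oplus Ominus : {set 'I_N})
  (Oplus_safe : safe_set X F c xi prb tau M Oplus)
  (Ominus_pruned : pruned_set X F c xi prb tau M Ominus)
  (Oplus_Ominus : jointly_compatible X F c xi prb tau M Oplus Ominus)
  (Oplus_nonoptimal : nu X F c xi Oplus <> Fstar X F c xi prb tau M)
  (Fhat : \bar R)
  (Fhat_neqNy : Fhat <> -oo%E)
  (Fstar_le_Fhat : (Fstar X F c xi prb tau M <= Fhat)%E) :
  (forall s : 'I_N, (Fhat < nu X F c xi (s |: Oplus)%SET)%E ->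
     pruned_set X F c xi prb tau M (s |: Ominus)%SET) /\
  (Fcheck X F c xi Oplus Ominus <= Fstar X F c xi prb tau M)%E.
Proof.
split=> [s Fhat_lt|].
- have Fstar_lt := le_lt_trans Fstar_le_Fhat Fhat_lt.
  have [|S] := jointly_compatible_attained Oplus_Ominus.
    exact: lt_le_trans Fstar_lt (leey _).
  rewrite finset.inE => /and3P[SOm OpS prbS] nuS.
  have sNS : s \notin S.
    apply: contraTN Fstar_lt => sS; rewrite -leNgt -nuS; apply: nu_subset.
    by rewrite finset.subUset finset.sub1set sS.
  apply: (pruned_of_disjoint M_max prbS); last by rewrite nuS.
  apply/fintype.subsetP => t tS; have := fintype.subsetP SOm _ tS.
  rewrite !finset.inE negb_or => ->; rewrite andbT.
  by apply: contraNneq sNS => <-.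
- have [->|] := eqVneq (Fstar X F c xi prb tau M) +oo%E; first exact: leey.
  rewrite -ltey => /(jointly_compatible_attained Oplus_Ominus)[S].
  rewrite finset.inE => /and3P[SOm OpS _] nuS.
  have : Oplus \proper S.
    rewrite finset.properEneq OpS andbT; apply/eqP => OpE.
    by apply: Oplus_nonoptimal; rewrite OpE.
  case/fintype.properP => _ [s sS sNOp]; rewrite -nuS.
  apply: (@le_trans _ _ (nu X F c xi (s |: Oplus)%SET)).
    apply: bigmin_le_cond; rewrite !finset.inE negb_or sNOp /=.
    by have := fintype.subsetP SOm _ sS; rewrite finset.inE.
  by apply: nu_subset; rewrite finset.subUset finset.sub1set sS.
Qed.
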